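(* Let $X_1,X_2,X_3$ be Polish spaces, $\mu_i\in\mathcal{P}(X_i)$, $\mu_{ij}=\mu_i\otimes\mu_j$ for $1\le i<j\le3$, and let $c:X_1\times X_2\times X_3\to[0,\infty)$ be bounded and continuous. Let $\{f_{ij}\}$ be a solution to the dual problem, i.e. $f_{ij}\in L^1(X_i\times X_j,\mu_{ij})$ real-valued with $f_{12}(x_1,x_2)+f_{13}(x_1,x_3)+f_{23}(x_2,x_3)\le c(x_1,x_2,x_3)$ for all $x$, maximizing $\sum_{i<j}\int f_{ij}\,d\mu_{ij}$ among all such tuples. Then $$f_{12}(x_1,x_2)+f_{13}(x_1,x_3)+f_{23}(x_2,x_3)\ge-12\|c\|_\infty$$ for $\mu_1\otimes\mu_2\otimes\mu_3$-almost every $x$. *)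

(* Defs.v *)
From HB Require Import structures.
From mathcomp Require Import all_boot all_order all_algebra.
From mathcomp Require Import all_classical all_reals all_analysis.

Set Implicit Arguments.
Unset Strict Implicit.
Unset Printing Implicit Defensive.

Import Order.TTheory GRing.Theory Num.Theory.
Local Open Scope classical_set_scope.
Local Open Scope ring_scope.

Definition completely_metrizable (R : realType) (T : ptopologicalType) : Prop :=
  exists d : T -> T -> R,
    [/\ (forall x y, d x y = 0 <-> x = y),
        (forall x y, d x y = d y x),
        (forall x y z, d x z <= d x y + d y z),
        (forall A : set T, open A <->
            (forall x, A x -> exists2 e : R, 0 < e & [set y | d x y < e] `<=` A))
      & (forall u : nat -> T,
           (forall e : R, 0 < e -> exists N, forall m n, (N <= m)%N -> (N <= n)%N ->
                d (u m) (u n) < e) ->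
           exists l : T, forall e : R, 0 < e -> exists N, forall n, (N <= n)%N ->
                d (u n) l < e)].

Definition separable_space (T : ptopologicalType) : Prop :=
  exists D : set T, countable D /\ dense D.

Definition polish_space (R : realType) (T : ptopologicalType) : Prop :=
  separable_space T /\ completely_metrizable R T.

Definition borel (T : ptopologicalType) : measurableType (@open T).-sigma :=
  g_sigma_algebraType (@open T).

Definition supnorm (R : realType) (T : Type) (c : T -> R) : R :=
  sup (range (fun x => `|c x|)).

Definition dual_admissible (R : realType) (X1 X2 X3 : ptopologicalType)
  (mu1 : probability (borel X1) R) (mu2 : probability (borel X2) R)
  (mu3 : probability (borel X3) R) (c : X1 * X2 * X3 -> R)
  (f12 : X1 * X2 -> R) (f13 : X1 * X3 -> R) (f23 : X2 * X3 -> R) : Prop :=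
  [/\ (mu1 \x mu2)%E.-integrable setT (fun x : borel X1 * borel X2 => (f12 x)%:E),
      (mu1 \x mu3)%E.-integrable setT (fun x : borel X1 * borel X3 => (f13 x)%:E),
      (mu2 \x mu3)%E.-integrable setT (fun x : borel X2 * borel X3 => (f23 x)%:E)
    & forall x1 x2 x3, f12 (x1, x2) + f13 (x1, x3) + f23 (x2, x3) <= c (x1, x2, x3)].

Definition dual_value (R : realType) (X1 X2 X3 : ptopologicalType)
  (mu1 : probability (borel X1) R) (mu2 : probability (borel X2) R)
  (mu3 : probability (borel X3) R)
  (f12 : X1 * X2 -> R) (f13 : X1 * X3 -> R) (f23 : X2 * X3 -> R) : \bar R :=
  (\int[(mu1 \x mu2)%E]_x (f12 x)%:E
   + \int[(mu1 \x mu3)%E]_x (f13 x)%:E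
   + \int[(mu2 \x mu3)%E]_x (f23 x)%:E)%E.

(* Main.v *)
Require Import Defs.
From HB Require Import structures.
From mathcomp Require Import all_boot all_order all_algebra.
From mathcomp Require Import all_classical all_reals all_analysis.
From mathcomp Require Import measurable_realfun lra.

Set Implicit Arguments.
Unset Strict Implicit.
Unset Printing Implicit Defensive.

Import Order.TTheory GRing.Theory Num.Theory numFieldNormedType.Exports.
Local Open Scope classical_set_scope.
Local Open Scope ring_scope.

(** Write [M] for the sup norm of [c], [F := f12 + f13 + f23 <= M], [I_ij] for
    the integral of [f_ij], [V] for the value, and [f_ij^i(x_i)] for the integral
    of [f_ij] in [x_j]. No primal solution is needed: two explicit perturbations
    of an optimal triple give, almost everywhere,
      [f12^1(x1) + f13^1(x1) >= I12 + I13 - M]                            (1)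
      [f12(x1, x2) >= f12^1(x1) + f12^2(x2) + I13 + I23 - 3 M]            (2)
    and the same bounds under permutation of the coordinates. Adding (2) over
    the three pairs and then (1) over the three coordinates yields
    [F >= 4 V - 12 M], and [V >= 0] because the zero triple is admissible. *)

(** An infinite section integral is read as 0; for integrable [f] this happens only on a null set,
    by Fubini. *)
Definition partial_int {d1 d2 : measure_display} {T1 : measurableType d1}
    {T2 : measurableType d2} {R : realType} (m2 : probability T2 R)
    (f : T1 * T2 -> R) (x : T1) : R :=
  \int[m2]_y f (x, y).

(** * Integrals against one probability measure *)

Section one_probability.
Context {d : measure_display} {T : measurableType d} {R : realType}.
Variable m : probability T R.

(** Turns optimality into an almost-everywhere statement: [h] will be the pointwise gain of a
    perturbation, whose integral cannot be positive. *)
Lemma ae_eq0_of_Rintegral_le0 (h : T -> R) :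
  m.-integrable setT (EFin \o h) -> {ae m, forall x, 0 <= h x} ->
  \int[m]_x h x <= 0 -> {ae m, forall x, h x = 0}.
Proof.
move=> ih h0 Ih.
have mh := measurable_int _ ih.
suff : ae_eq m setT (EFin \o h) (cst 0%E).
  by apply: filterS => x /(_ I) [].
apply/ae_eq_integral_abs => //; apply/eqP; rewrite eq_le; apply/andP; split;
  last exact: integral_ge0.
rewrite (_ : integral _ _ _ = (\int[m]_x (h x)%:E)%E); last first.
  apply: ae_eq_integral => //; first by apply: (measurableT_comp _ mh). 
  by apply: filterS h0 => x hx _; rewrite /= ger0_norm.
have := integrable_fin_num measurableT ih.
by move=> /fineK <-; rewrite lee_fin.
Qed.

Lemma ae_exists (P : T -> Prop) : {ae m, forall x, P x} -> exists x, P x.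
Proof.
move=> [N [mN N0 PN]]; apply: contrapT => nP.
have NT : N = setT.
  by rewrite eqEsubset; split => // x _; apply: PN => /= Px; apply: nP; exists x.
have := probability_setT m; rewrite -NT [LHS]N0 => /eqP.
by rewrite eqe eq_sym oner_eq0.
Qed.

Lemma integrable_cstR (r : R) : m.-integrable setT (fun=> r%:E).
Proof. exact: finite_measure_integrable_cst. Qed.

Lemma Rintegral_cst_prob (r : R) : \int[m]_x r = r.
Proof. by rewrite Rintegral_cst//= probability_setT mulr1. Qed.

(** Otherwise [a] lies almost everywhere below its mean [I]; then [I - a] is nonnegative with
    integral zero, so it vanishes almost everywhere, a contradiction. *)
Lemma exists_ge_mean (P : T -> Prop) (a : T -> R) :
  m.-integrable setT (EFin \o a) -> {ae m, forall x, P x} ->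
  exists x, P x /\ \int[m]_y a y <= a x.
Proof.
move=> ia aeP; apply: contrapT => nex.
have lt_a : {ae m, forall x, a x < \int[m]_y a y}.
  apply: filterS aeP => x Px; rewrite ltNge; apply/negP => ax.
  by apply: nex; exists x.
set I := \int[m]_y a y in lt_a.
have /ae_exists[x []] :
    {ae m, forall x, I - a x = 0 /\ a x < I}.
  apply: filterI; last exact: lt_a.
  apply: ae_eq0_of_Rintegral_le0.
  - exact: (integrableB measurableT (integrable_cstR I) ia).
  - by apply: filterS lt_a => x ax; lra.
  - rewrite RintegralB//; last exact: integrable_cstR.
    by rewrite Rintegral_cst_prob subrr.
by move=> ? ?; lra.
Qed.

Lemma integrable_if (b : T -> bool) (f g : T -> R) :
  measurable_fun setT b ->
  m.-integrable setT (EFin \o f) -> m.-integrable setT (EFin \o g) ->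
  m.-integrable setT (fun x => (if b x then f x else g x)%:E).
Proof.
move=> mb iF iG.
have mf := measurable_int _ iF; have mg := measurable_int _ iG.
apply: (@le_integrable _ _ _ _ _ _ _ (fun x => (`|f x| + `|g x|)%:E)) => //.
- under eq_fun do rewrite (fun_if EFin).
  exact: measurable_fun_ifT.
- move=> x _; rewrite lee_fin [leRHS]ger0_norm ?addr_ge0//.
  by case: ifP => _; rewrite ?lerDl ?lerDr.
- under eq_fun do rewrite EFinD.
  by apply: integrableD => //; exact: integrable_norm.
Qed.

(** Serves to integrate the dual constraint in one variable; [k] is the term that does not depend on
    it. *)
Lemma le_sub_Rintegral (u v : T -> R) (k M : R) :
  m.-integrable setT (EFin \o u) -> m.-integrable setT (EFin \o v) ->
  (forall x, u x + k + v x <= M) ->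
  k <= M - \int[m]_x u x - \int[m]_x v x.
Proof.
move=> iu iv uv.
suff : \int[m]_x (u x + v x) <= \int[m]_x (M - k).
  by rewrite RintegralD// Rintegral_cst_prob => ?; lra.
apply: le_Rintegral => //.
- exact: (integrableD measurableT iu iv).
- exact: integrable_cstR.
- by move=> x _; have := uv x; lra.
Qed.

Lemma integrable_fine (g : T -> \bar R) :
  m.-integrable setT g -> m.-integrable setT (EFin \o (fine \o g)).
Proof.
move=> ig; have mg := measurable_int _ ig.
apply: (le_integrable measurableT _ _ ig).
  by apply/measurable_EFinP; exact: measurableT_comp.
by move=> x _ /=; case: (g x) => [r||] /=; rewrite ?normr0 ?leey.
Qed.

End one_probability.

(** * Fubini and null sets for a product of two probabilities *)

Section two_probabilities.
Context {d1 d2 : measure_display} {T1 : measurableType d1}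
  {T2 : measurableType d2} {R : realType}.
Variables (m1 : probability T1 R) (m2 : probability T2 R).

(** By Tonelli, integrability can be tested on the iterated integral of the absolute value in either
    order. *)
Lemma integrable_swap (f : T1 * T2 -> R) :
  (m1 \x m2)%E.-integrable setT (EFin \o f) ->
  (m2 \x m1)%E.-integrable setT (EFin \o (f \o swap_pair)).
Proof.
move=> iF; have mf := measurable_int _ iF.
apply/integrable12ltyP; last exact/(integrable21ltyP m1 m2 mf).
by apply: (measurableT_comp mf); exact: measurable_fun_pair.
Qed.

Section integrable.
Variable f : T1 * T2 -> R.
Hypothesis iF : (m1 \x m2)%E.-integrable setT (EFin \o f).

Lemma integrable_partial_int :
  m1.-integrable setT (EFin \o partial_int m2 f).
Proof. exact: (integrable_fine (integrable_fubini_F iF)). Qed.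

(** Fubini: [fine] alters the inner integral only on the null set where it is infinite. *)
Lemma Rintegral_partial_int :
  \int[m1]_x partial_int m2 f x = \int[(m1 \x m2)%E]_z f z.
Proof.
have iF1 := integrable_fubini_F iF.
rewrite /Rintegral -(integral12_prod_meas1 iF); congr fine.
apply: ae_eq_integral => //.
- exact: (measurable_int _ integrable_partial_int).
- exact: (measurable_int _ iF1).
- by apply: filterS (integrable_ae measurableT iF1) => x + _ => /(_ I) /fineK.
Qed.

Lemma ae_integrable_section :
  {ae m1, forall x, m2.-integrable setT (fun y => (f (x, y))%:E)}.
Proof. exact: (ae_integrable1 iF). Qed.

Lemma Rintegral_swap :
  \int[(m2 \x m1)%E]_z f (swap_pair z) = \int[(m1 \x m2)%E]_z f z.
Proof.
rewrite /Rintegral -(integral21_prod_meas1 iF).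
by rewrite -(integral12_prod_meas1 (integrable_swap iF)).
Qed.

End integrable.

Lemma integrable_snd (g : T2 -> R) :
  m2.-integrable setT (EFin \o g) ->
  (m1 \x m2)%E.-integrable setT (fun p => (g p.2)%:E).
Proof.
move=> ig; have mg := measurable_int _ ig.
apply/integrable12ltyP; first by apply: (measurableT_comp mg).
rewrite /= integral_cst//= probability_setT mule1.
by case/integrableP : ig.
Qed.

Lemma ae_fst (P : T1 -> Prop) :
  {ae m1, forall x, P x} -> {ae (m1 \x m2)%E, forall p, P p.1}.
Proof.
move=> [N [mN N0 PN]]; exists (N `*` setT); split.
- exact: measurableX.
- by rewrite product_measure1E//= N0 mul0e.
- by move=> [x y] /= nP; split => //; exact: PN.
Qed.

Lemma ae_snd (P : T2 -> Prop) :
  {ae m2, forall x, P x} -> {ae (m1 \x m2)%E, forall p, P p.2}.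
Proof.
move=> [N [mN N0 PN]]; exists (setT `*` N); split.
- exact: measurableX.
- by rewrite product_measure1E//= N0 mule0.
- by move=> [x y] /= nP; split => //; exact: PN.
Qed.

End two_probabilities.

(** * The dual problem on measurable spaces *)

(** The cost is curried and the three spaces are arbitrary, so that a permuted problem is again an
    instance of the same definition. *)
Definition admissible {d1 d2 d3 : measure_display} {T1 : measurableType d1}
    {T2 : measurableType d2} {T3 : measurableType d3} {R : realType}
    (m1 : probability T1 R) (m2 : probability T2 R) (m3 : probability T3 R)
    (c : T1 -> T2 -> T3 -> R)
    (f12 : T1 * T2 -> R) (f13 : T1 * T3 -> R) (f23 : T2 * T3 -> R) : Prop :=
  [/\ (m1 \x m2)%E.-integrable setT (EFin \o f12),
      (m1 \x m3)%E.-integrable setT (EFin \o f13),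
      (m2 \x m3)%E.-integrable setT (EFin \o f23)
    & forall x1 x2 x3, f12 (x1, x2) + f13 (x1, x3) + f23 (x2, x3) <= c x1 x2 x3].

Definition value {d1 d2 d3 : measure_display} {T1 : measurableType d1}
    {T2 : measurableType d2} {T3 : measurableType d3} {R : realType}
    (m1 : probability T1 R) (m2 : probability T2 R) (m3 : probability T3 R)
    (f12 : T1 * T2 -> R) (f13 : T1 * T3 -> R) (f23 : T2 * T3 -> R) : R :=
  \int[(m1 \x m2)%E]_x f12 x + \int[(m1 \x m3)%E]_x f13 x
  + \int[(m2 \x m3)%E]_x f23 x.

Definition optimal {d1 d2 d3 : measure_display} {T1 : measurableType d1}
    {T2 : measurableType d2} {T3 : measurableType d3} {R : realType}
    (m1 : probability T1 R) (m2 : probability T2 R) (m3 : probability T3 R)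
    (c : T1 -> T2 -> T3 -> R)
    (f12 : T1 * T2 -> R) (f13 : T1 * T3 -> R) (f23 : T2 * T3 -> R) : Prop :=
  admissible m1 m2 m3 c f12 f13 f23 /\
  forall g12 g13 g23, admissible m1 m2 m3 c g12 g13 g23 ->
    value m1 m2 m3 g12 g13 g23 <= value m1 m2 m3 f12 f13 f23.

(** * Invariance under permutations of the coordinates *)

Section symmetries.
Context {d1 d2 d3 : measure_display} {T1 : measurableType d1}
  {T2 : measurableType d2} {T3 : measurableType d3} {R : realType}.
Variables (m1 : probability T1 R) (m2 : probability T2 R)
  (m3 : probability T3 R) (c : T1 -> T2 -> T3 -> R).
Variables (f12 : T1 * T2 -> R) (f13 : T1 * T3 -> R) (f23 : T2 * T3 -> R).

Lemma admissible_swap12 : admissible m1 m2 m3 c f12 f13 f23 ->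
  admissible m2 m1 m3 (fun x2 x1 x3 => c x1 x2 x3) (f12 \o swap_pair) f23 f13.
Proof.
move=> [i12 i13 i23 le_c]; split => //; first exact: integrable_swap.
by move=> x2 x1 x3; rewrite -addrA (addrC (f23 _)) addrA; exact: le_c.
Qed.

Lemma admissible_swap23 : admissible m1 m2 m3 c f12 f13 f23 ->
  admissible m1 m3 m2 (fun x1 x3 x2 => c x1 x2 x3) f13 f12 (f23 \o swap_pair).
Proof.
move=> [i12 i13 i23 le_c]; split => //; first exact: integrable_swap.
by move=> x1 x3 x2; rewrite (addrC (f13 _)); exact: le_c.
Qed.

Lemma value_swap12 : admissible m1 m2 m3 c f12 f13 f23 ->
  value m2 m1 m3 (f12 \o swap_pair) f23 f13 = value m1 m2 m3 f12 f13 f23.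
Proof.
by move=> [i12 _ _ _]; rewrite /value -(Rintegral_swap i12) addrAC.
Qed.

Lemma value_swap23 : admissible m1 m2 m3 c f12 f13 f23 ->
  value m1 m3 m2 f13 f12 (f23 \o swap_pair) = value m1 m2 m3 f12 f13 f23.
Proof.
move=> [_ _ i23 _]; rewrite /value -(Rintegral_swap i23).
by rewrite (addrC (Rintegral _ _ f13)).
Qed.

End symmetries.

Section optimal_symmetries.
Context {d1 d2 d3 : measure_display} {T1 : measurableType d1}
  {T2 : measurableType d2} {T3 : measurableType d3} {R : realType}.
Variables (m1 : probability T1 R) (m2 : probability T2 R)
  (m3 : probability T3 R) (c : T1 -> T2 -> T3 -> R).
Variables (f12 : T1 * T2 -> R) (f13 : T1 * T3 -> R) (f23 : T2 * T3 -> R).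
Hypothesis opt : optimal m1 m2 m3 c f12 f13 f23.

(** The exchange is an involution, so a competitor of the exchanged problem pulls back to one of the
    original problem with the same value. Together with [optimal_swap23] it generates all
    permutations. *)
Lemma optimal_swap12 :
  optimal m2 m1 m3 (fun x2 x1 x3 => c x1 x2 x3) (f12 \o swap_pair) f23 f13.
Proof.
case: opt => adm max_f; split; first exact: admissible_swap12.
move=> g12 g13 g23 adm_g; rewrite (value_swap12 adm) -(value_swap12 adm_g).
exact/max_f/(admissible_swap12 adm_g).
Qed.

Lemma optimal_swap23 :
  optimal m1 m3 m2 (fun x1 x3 x2 => c x1 x2 x3) f13 f12 (f23 \o swap_pair).
Proof.
case: opt => adm max_f; split; first exact: admissible_swap23.
move=> g12 g13 g23 adm_g; rewrite (value_swap23 adm) -(value_swap23 adm_g).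
exact/max_f/(admissible_swap23 adm_g).
Qed.

End optimal_symmetries.

(** * The lower bound (1) in one coordinate *)

Section lower_bounds.
Context {d1 d2 d3 : measure_display} {T1 : measurableType d1}
  {T2 : measurableType d2} {T3 : measurableType d3} {R : realType}.
Variables (m1 : probability T1 R) (m2 : probability T2 R)
  (m3 : probability T3 R) (c : T1 -> T2 -> T3 -> R) (M : R).
Hypothesis c_ge0 : forall x1 x2 x3, 0 <= c x1 x2 x3.
Hypothesis c_leM : forall x1 x2 x3, c x1 x2 x3 <= M.

(* If the bound fails at [x], replacing the section of [f] at [x] by the
   section at a point [z] above the mean, lowered by [M], increases the value. *)
Lemma partial_int_ge
    (f12 : T1 * T2 -> R) (f13 : T1 * T3 -> R) (f23 : T2 * T3 -> R) :
  optimal m1 m2 m3 c f12 f13 f23 ->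
  {ae m1, forall x, \int[(m1 \x m2)%E]_p f12 p + \int[(m1 \x m3)%E]_p f13 p - M
                    <= partial_int m2 f12 x + partial_int m3 f13 x}.
Proof.
move=> [[i12 i13 i23 le_c] max_f].
pose a x := partial_int m2 f12 x + partial_int m3 f13 x.
have ip12 := integrable_partial_int i12.
have ip13 := integrable_partial_int i13.
have ia : m1.-integrable setT (EFin \o a).
  exact: (integrableD measurableT ip12 ip13).
have Ia : \int[m1]_x a x =
    \int[(m1 \x m2)%E]_p f12 p + \int[(m1 \x m3)%E]_p f13 p.
  by rewrite RintegralD// !Rintegral_partial_int.
rewrite -Ia.
(* Integrable sections at [z] are what makes the perturbed functions below integrable. *)
have [z [[iz12 iz13] Iaz]] := exists_ge_mean ia
  (filterI (ae_integrable_section i12) (ae_integrable_section i13)).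
(* Comparing with [a z - M], not with the mean minus [M], ensures that the replacement never
   decreases [a]. *)
pose b x := a x <= a z - M.
have mb : measurable_fun setT b.
  by apply: measurable_fun_ler => //; exact/measurable_EFinP/measurable_int/ia.
pose g12 p := if b p.1 then f12 (z, p.2) - M else f12 p.
pose g13 p := if b p.1 then f13 (z, p.2) else f13 p.
have ig12 : (m1 \x m2)%E.-integrable setT (EFin \o g12).
  apply: (@integrable_if _ _ _ (m1 \x m2)%E) => //.
    exact: measurableT_comp.
  apply: (@integrable_snd _ _ _ _ _ m1 m2 (fun y => f12 (z, y) - M)).
  exact: (integrableB measurableT iz12 (integrable_cstR m2 M)).
have ig13 : (m1 \x m3)%E.-integrable setT (EFin \o g13).
  apply: (@integrable_if _ _ _ (m1 \x m3)%E) => //.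
    exact: measurableT_comp.
  exact: (@integrable_snd _ _ _ _ _ m1 m3 (fun y => f13 (z, y))).
have /max_f : admissible m1 m2 m3 c g12 g13 f23.
  split => // x1 x2 x3; rewrite /g12 /g13 /=; case: ifP => _; last exact: le_c.
  (* The replaced sum is at most [c z x2 x3 - M <= 0 <= c x1 x2 x3]. *)
  have := le_c z x2 x3; have := c_leM z x2 x3; have := c_ge0 x1 x2 x3; lra.
rewrite /value lerD2r -Ia => le_Ia.
have pg x : partial_int m2 g12 x + partial_int m3 g13 x
    = if b x then a z - M else a x.
  rewrite /partial_int /g12 /g13 /=; case: ifP => _ //.
  rewrite RintegralB//; last exact: integrable_cstR.
  by rewrite Rintegral_cst_prob /a /partial_int; lra.
have ipg : m1.-integrable setT (EFin \o (fun x => if b x then a z - M else a x)).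
  by apply: integrable_if => //; exact: integrable_cstR.
have : {ae m1, forall x, (if b x then a z - M else a x) - a x = 0}.
  apply: ae_eq0_of_Rintegral_le0.
  - exact: (integrableB measurableT ipg ia).
  - by apply: aeW => x; case: ifP => //; rewrite ?subrr// subr_ge0.
  - rewrite RintegralB// subr_le0 (le_trans _ le_Ia)//.
    under eq_Rintegral do rewrite -pg.
    rewrite RintegralD ?Rintegral_partial_int//; exact: integrable_partial_int.
(* Where [b x] holds, zero gain gives [a x = a z - M]; elsewhere [a x > a z - M]. Both suffice, as
   [a z] is at least the mean. *)
apply: filterS => x; rewrite -/(a x); case: ifP; rewrite /b; last first.
  by move=> /negbT; rewrite -ltNge => ? _; lra.
by move=> _ ?; lra.
Qed.

End lower_bounds.

(** * The lower bound (2) for a pair function *)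

Section pair_bound.
Context {d1 d2 d3 : measure_display} {T1 : measurableType d1}
  {T2 : measurableType d2} {T3 : measurableType d3} {R : realType}.
Variables (m1 : probability T1 R) (m2 : probability T2 R)
  (m3 : probability T3 R) (c : T1 -> T2 -> T3 -> R) (M : R).
Hypothesis c_ge0 : forall x1 x2 x3, 0 <= c x1 x2 x3.
Hypothesis c_leM : forall x1 x2 x3, c x1 x2 x3 <= M.

(** Bound (1) for the third coordinate: two successive exchanges bring it to the first place. *)
Lemma partial_int_ge3
    (f12 : T1 * T2 -> R) (f13 : T1 * T3 -> R) (f23 : T2 * T3 -> R) :
  optimal m1 m2 m3 c f12 f13 f23 ->
  {ae m3, forall y, \int[(m1 \x m3)%E]_p f13 p + \int[(m2 \x m3)%E]_p f23 p - M
                    <= partial_int m1 (f13 \o swap_pair) y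
                       + partial_int m2 (f23 \o swap_pair) y}.
Proof.
move=> opt; have [[_ i13 i23 _] _] := opt.
rewrite -(Rintegral_swap i13) -(Rintegral_swap i23).
apply: (partial_int_ge _ _ (optimal_swap12 (optimal_swap23 opt))) => *.
  exact: c_ge0.
exact: c_leM.
Qed.

(* Integrating [f12 + f13 + f23 <= M] in [x2], resp. in [x1], bounds
   [f13(x1, y)] and [f23(x2, y)] from above by one-variable functions; with
   [partial_int_ge3], [lb p + f13 + f23 <= 0] off null sets. The perturbation
   [h] raises [f12] towards [lb], and lowering [f13] by [1] above the null set
   [N3] restores admissibility at no cost. *)
Lemma pair_function_ge
    (f12 : T1 * T2 -> R) (f13 : T1 * T3 -> R) (f23 : T2 * T3 -> R) :
  optimal m1 m2 m3 c f12 f13 f23 ->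
  {ae (m1 \x m2)%E, forall p,
    partial_int m2 f12 p.1 + partial_int m1 (f12 \o swap_pair) p.2
    + \int[(m1 \x m3)%E]_q f13 q + \int[(m2 \x m3)%E]_q f23 q - 3 * M
    <= f12 p}.
Proof.
move=> opt; have [[i12 i13 i23 le_c] max_f] := opt.
have le_M x1 x2 x3 : f12 (x1, x2) + f13 (x1, x3) + f23 (x2, x3) <= M.
  exact: le_trans (le_c x1 x2 x3) (c_leM x1 x2 x3).
set I13 := Rintegral _ _ f13; set I23 := Rintegral _ _ f23.
pose lb p := partial_int m2 f12 p.1 + partial_int m1 (f12 \o swap_pair) p.2
  + I13 + I23 - 3 * M.
have ae3 : {ae m3, forall y,
    [/\ m1.-integrable setT (fun x => (f13 (x, y))%:E),
        m2.-integrable setT (fun x => (f23 (x, y))%:E) &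
        I13 + I23 - M <= partial_int m1 (f13 \o swap_pair) y
                         + partial_int m2 (f23 \o swap_pair) y]}.
  have := partial_int_ge3 opt.
  have := ae_integrable_section (integrable_swap i23).
  have := ae_integrable_section (integrable_swap i13).
  by apply: filterS3 => y ? ? ?; split.
(* Admissibility is required at every point, so the exceptional sets are fixed as explicit
   measurable null sets. *)
have [N1 [mN1 N10 good1]] := ae_integrable_section i12.
have [N2 [mN2 N20 good2]] := ae_integrable_section (integrable_swap i12).
have [N3 [mN3 N30 good3]] := ae3.
(* Of the [3 * M] in [lb], one [M] comes from each of the two integrated constraints and one from
   [partial_int_ge3]. *)
have key x1 x2 y : ~ N1 x1 -> ~ N2 x2 -> ~ N3 y ->
    lb (x1, x2) + f13 (x1, y) + f23 (x2, y) <= 0.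
  move=> n1 n2 n3.
  have j12 : m2.-integrable setT (fun x => (f12 (x1, x))%:E).
    by apply: contrapT => /good1.
  have j21 : m1.-integrable setT (fun x => (f12 (x, x2))%:E).
    by apply: contrapT => /good2.
  have [j31 j32 ge3] : [/\ m1.-integrable setT (fun x => (f13 (x, y))%:E),
        m2.-integrable setT (fun x => (f23 (x, y))%:E) &
        I13 + I23 - M <= partial_int m1 (f13 \o swap_pair) y
                         + partial_int m2 (f23 \o swap_pair) y].
    by apply: contrapT => /good3.
  have := le_sub_Rintegral j12 j32 (fun x => le_M x1 x y).
  have le_M' x : f12 (x, x2) + f23 (x2, y) + f13 (x, y) <= M.
    by have := le_M x x2 y; lra.
  have := le_sub_Rintegral j21 j31 le_M'.
  by move: ge3; rewrite /lb /partial_int /=; lra.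
(* The positive part of [lb - f12], cut at 1: the cut makes it integrable and lets a decrease of
   [f13] by 1 absorb it. *)
pose h0 p := Num.min 1 (Num.max 0 (lb p - f12 p)).
pose h := h0 \_ (~` N1 `*` ~` N2).
have h0_01 p : 0 <= h0 p <= 1.
  by rewrite /h0 ge_min lexx le_min ler01 le_max lexx.
have h0P p : lb p <= f12 p /\ h0 p = 0 \/ 0 < h0 p <= lb p - f12 p.
  have [lb_le|lt_lb] := leP (lb p) (f12 p); [left|right].
    by split => //; rewrite /h0 max_l ?subr_le0// min_r.
  have lb_gt0 : 0 < lb p - f12 p by rewrite subr_gt0.
  by rewrite /h0 (max_r (ltW lb_gt0)) lt_min ltr01 lb_gt0 ge_min lexx orbT.
have hE p : h p = if p \in ~` N1 `*` ~` N2 then h0 p else 0.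
  by rewrite /h patchE.
have h_01 p : 0 <= h p <= 1.
  by rewrite hE; case: ifP => // _; rewrite lexx ler01.
have mh : measurable_fun setT h.
  have mN12 := measurableX (measurableC mN1) (measurableC mN2).
  apply/(measurable_restrictT h0 mN12).
  have /measurable_int/measurable_EFinP mf12 := i12.
  have /measurable_int/measurable_EFinP mp1 := integrable_partial_int i12.
  have /measurable_int/measurable_EFinP mp2 :=
    integrable_partial_int (integrable_swap i12).
  apply: measurable_funTS; apply: measurable_minr; first exact: measurable_cst.
  apply: measurable_maxr; first exact: measurable_cst.
  apply: measurable_funB mf12; apply: measurable_funB => //.
  do 2 apply: measurable_funD => //.
  by apply: measurable_funD; [exact: (measurableT_comp mp1)|
                             exact: (measurableT_comp mp2)].
have ih : (m1 \x m2)%E.-integrable setT (EFin \o h).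
  apply: (le_integrable measurableT _ _ (integrable_cstR (m1 \x m2)%E 1)).
    exact/measurable_EFinP.
  move=> p _; rewrite /= lee_fin normr1 ger0_norm; by case/andP: (h_01 p).
have ih3 : m3.-integrable setT (EFin \o \1_N3) by exact: integrable_indic.
have ig12 := integrableD measurableT i12 ih.
have i3 := integrable_snd m1 ih3.
have ig13 := integrableB measurableT i13 i3.
have /max_f : admissible m1 m2 m3 c
    (fun p => f12 p + h p) (fun p => f13 p - \1_N3 p.2) f23.
  split => // x1 x2 y /=; rewrite indicE.
  have := le_c x1 x2 y; have /andP[h_ge0 h_le1] := h_01 (x1, x2).
  (* Above [N3] the decrease of [f13] offsets [h <= 1]. Elsewhere either [h] is 0 and the old
     constraint applies, or [f12 + h <= lb] and [key] bounds the sum by [0 <= c]. *)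
  have [_ /=|/= ] := boolP (y \in N3); first by lra.
  rewrite notin_setE => n3 le_cxy.
  rewrite hE; case: ifPn => [|_]; last by lra.
  rewrite inE => -[/= n1 n2].
  have lb_le := key x1 x2 y n1 n2 n3; have cxy_ge0 := c_ge0 x1 x2 y.
  by have [[? ?]|/andP[? ?]] := h0P (x1, x2); lra.
have I3 : \int[(m1 \x m3)%E]_p \1_N3 p.2 = 0 :> R.
  rewrite -(Rintegral_partial_int i3) /partial_int /=.
  rewrite [X in Rintegral _ _ (fun=> X)](_ : _ = 0) ?Rintegral_cst_prob//.
  by rewrite /Rintegral integral_indic//= setIT N30.
rewrite /value lerD2r RintegralD// RintegralB// I3 => le_f.
have : {ae (m1 \x m2)%E, forall p, h p = 0}.
  apply: (@ae_eq0_of_Rintegral_le0 _ _ _ (m1 \x m2)%E) => //.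
    by apply: aeW => p; case/andP: (h_01 p).
  by lra.
have ae1 : {ae (m1 \x m2)%E, forall p, ~ N1 p.1}.
  apply: (ae_fst m2 (P := fun x => ~ N1 x)).
  by exists N1; split => // x /contrapT.
have ae2 : {ae (m1 \x m2)%E, forall p, ~ N2 p.2}.
  apply: (ae_snd m1 (P := fun x => ~ N2 x)).
  by exists N2; split => // x /contrapT.
move: ae1 ae2; apply: filterS3 => -[x1 x2] n1 n2.
rewrite hE ifT; last by rewrite inE.
(* Off the null sets [h0] vanishes, which excludes the second alternative of [h0P]. *)
by rewrite -/(lb (x1, x2)); have [[]|/andP[? ?]] := h0P (x1, x2); lra.
Qed.

End pair_bound.

(** * Transfer of almost-everywhere statements to the triple product *)

(** The pushforward of [m] by [phi] agrees with the product measure on rectangles, hence everywhere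
    by uniqueness, so preimages of null sets are null. *)
Lemma ae_preimage {d d1 d2 : measure_display} {S : measurableType d}
    {T1 : measurableType d1} {T2 : measurableType d2} {R : realType}
    (m : probability S R) (m1 : probability T1 R) (m2 : probability T2 R)
    (phi : S -> T1 * T2) (P : T1 * T2 -> Prop) :
  measurable_fun setT phi ->
  (forall A B, measurable A -> measurable B ->
     m (phi @^-1` (A `*` B)) = (m1 A * m2 B)%E) ->
  {ae (m1 \x m2)%E, forall p, P p} -> {ae m, forall x, P (phi x)}.
Proof.
move=> mphi mE [N [mN N0 PN]]; exists (phi @^-1` N); split.
- by rewrite -[X in measurable X]setTI; exact: mphi.
- have := @product_measure_unique _ _ _ _ _ m1 m2 (pushforward m phi).
  by move=> /(_ mphi mE _ mN); rewrite [LHS]N0.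
- by move=> x nP; exact: PN.
Qed.

Section product_projections.
Context {d1 d2 d3 : measure_display} {T1 : measurableType d1}
  {T2 : measurableType d2} {T3 : measurableType d3} {R : realType}.
Variables (m1 : probability T1 R) (m2 : probability T2 R)
  (m3 : probability T3 R).

Lemma ae_proj13 (P : T1 * T3 -> Prop) :
  {ae (m1 \x m3)%E, forall p, P p} ->
  {ae ((m1 \x m2) \x m3)%E, forall x, P (x.1.1, x.2)}.
Proof.
apply: (@ae_preimage _ _ _ _ _ _ _ ((m1 \x m2) \x m3)%E).
  apply: measurable_fun_pair; last exact: measurable_snd.
  exact: (measurableT_comp measurable_fst measurable_fst).
move=> A B mA mB; rewrite (_ : _ @^-1` _ = (A `*` setT) `*` B); last first.
  by apply/seteqP; split => -[[x y] z] /= => [[]|[[]]].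
rewrite [LHS]product_measure1E//; last exact: measurableX.
by rewrite [X in (X * _)%E]product_measure1E//= probability_setT mule1.
Qed.

Lemma ae_proj23 (P : T2 * T3 -> Prop) :
  {ae (m2 \x m3)%E, forall p, P p} ->
  {ae ((m1 \x m2) \x m3)%E, forall x, P (x.1.2, x.2)}.
Proof.
apply: (@ae_preimage _ _ _ _ _ _ _ ((m1 \x m2) \x m3)%E).
  apply: measurable_fun_pair; last exact: measurable_snd.
  exact: (measurableT_comp measurable_snd measurable_fst).
move=> A B mA mB; rewrite (_ : _ @^-1` _ = (setT `*` A) `*` B); last first.
  by apply/seteqP; split => -[[x y] z] /= => [[]|[[]]].
rewrite [LHS]product_measure1E//; last exact: measurableX.
by rewrite [X in (X * _)%E]product_measure1E//= probability_setT mul1e.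
Qed.

End product_projections.

(** * Summation of the bounds *)

Lemma optimal_sum_ge {d1 d2 d3 : measure_display} {T1 : measurableType d1}
    {T2 : measurableType d2} {T3 : measurableType d3} {R : realType}
    (m1 : probability T1 R) (m2 : probability T2 R) (m3 : probability T3 R)
    (c : T1 -> T2 -> T3 -> R) (M : R)
    (f12 : T1 * T2 -> R) (f13 : T1 * T3 -> R) (f23 : T2 * T3 -> R) :
  (forall x1 x2 x3, 0 <= c x1 x2 x3) -> (forall x1 x2 x3, c x1 x2 x3 <= M) ->
  optimal m1 m2 m3 c f12 f13 f23 ->
  {ae ((m1 \x m2) \x m3)%E, forall x,
    4 * value m1 m2 m3 f12 f13 f23 - 12 * M
    <= f12 (x.1.1, x.1.2) + f13 (x.1.1, x.2) + f23 (x.1.2, x.2)}.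
Proof.
move=> c_ge0 c_leM opt; have [[i12 i13 i23 _] _] := opt.
have opt12 := optimal_swap12 opt.
have coord1 := ae_fst m3 (ae_fst m2 (partial_int_ge c_ge0 c_leM opt)).
have coord2 := ae_fst m3 (ae_snd m1
  (partial_int_ge (fun x2 x1 => c_ge0 x1 x2) (fun x2 x1 => c_leM x1 x2) opt12)).
have coord3 := ae_snd (m1 \x m2)%E (partial_int_ge3 c_ge0 c_leM opt).
have pair12 := ae_fst m3 (pair_function_ge c_ge0 c_leM opt).
have pair13 := ae_proj13 m2 (pair_function_ge (fun x1 x3 x2 => c_ge0 x1 x2 x3)
  (fun x1 x3 x2 => c_leM x1 x2 x3) (optimal_swap23 opt)).
(* The two exchanges put the coordinates in the order 2, 3, 1. *)
have pair23 := ae_proj23 m1 (pair_function_ge (fun x2 x3 x1 => c_ge0 x1 x2 x3)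
  (fun x2 x3 x1 => c_leM x1 x2 x3) (optimal_swap23 opt12)).
(* The pair bounds add up to all six partial integrals plus [2 V - 9 M]; the coordinate bounds make
   these partial integrals at least [2 V - 3 M]. *)
move: coord1 coord2 coord3; apply: filter_app3.
move: pair12 pair13 pair23; apply: filterS3 => -[[x1 x2] x3] /=.
rewrite (Rintegral_swap i12) (Rintegral_swap i13) (Rintegral_swap i23) /value.
by move=> *; lra.
Qed.

(** * Return to the Borel setting *)

Lemma le_supnorm {R : realType} {T : Type} (c : T -> R) (x : T) :
  (exists M : R, forall y, `|c y| <= M) -> c x <= supnorm c.
Proof.
move=> [M cM]; apply: le_trans (ler_norm _) _.
apply: ub_le_sup; last by exists x.
by exists M => _ [y _ <-].
Qed.

(** Integrability makes the three integrals finite, so no information is lost in passing to real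
    values. *)
Lemma dual_value_fine {R : realType} {X1 X2 X3 : ptopologicalType}
    (mu1 : probability (borel X1) R) (mu2 : probability (borel X2) R)
    (mu3 : probability (borel X3) R) (c : X1 * X2 * X3 -> R)
    (f12 : X1 * X2 -> R) (f13 : X1 * X3 -> R) (f23 : X2 * X3 -> R) :
  dual_admissible mu1 mu2 mu3 c f12 f13 f23 ->
  dual_value mu1 mu2 mu3 f12 f13 f23
  = (@value _ _ _ (borel X1) (borel X2) (borel X3) R mu1 mu2 mu3 f12 f13 f23)%:E.
Proof.
move=> [i12 i13 i23 _]; rewrite /value /Rintegral !EFinD.
by rewrite !fineK//; exact: integrable_fin_num.
Qed.

Lemma dual_value_ge0 {R : realType} {X1 X2 X3 : ptopologicalType}
    (mu1 : probability (borel X1) R) (mu2 : probability (borel X2) R)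
    (mu3 : probability (borel X3) R) (c : X1 * X2 * X3 -> R)
    (f12 : X1 * X2 -> R) (f13 : X1 * X3 -> R) (f23 : X2 * X3 -> R) :
  (forall x, 0 <= c x) ->
  (forall (g12 : X1 * X2 -> R) (g13 : X1 * X3 -> R) (g23 : X2 * X3 -> R),
      dual_admissible mu1 mu2 mu3 c g12 g13 g23 ->
      (dual_value mu1 mu2 mu3 g12 g13 g23 <= dual_value mu1 mu2 mu3 f12 f13 f23)%E) ->
  (0 <= dual_value mu1 mu2 mu3 f12 f13 f23)%E.
Proof.
move=> c_ge0 hmax.
have adm0 : dual_admissible mu1 mu2 mu3 c (fun=> 0) (fun=> 0) (fun=> 0).
  split; try exact: integrable0.
  by move=> x1 x2 x3; rewrite !addr0.
by apply: le_trans (hmax _ _ _ adm0); rewrite /dual_value !integral0 !adde0.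
Qed.

Theorem mainTheorem15 (R : realType) (X1 X2 X3 : ptopologicalType)
  (hX1 : polish_space R X1) (hX2 : polish_space R X2) (hX3 : polish_space R X3)
  (mu1 : probability (borel X1) R) (mu2 : probability (borel X2) R)
  (mu3 : probability (borel X3) R)
  (c : X1 * X2 * X3 -> R)
  (c_ge0 : forall x, 0 <= c x)
  (c_bounded : exists M : R, forall x, `|c x| <= M)
  (c_cont : continuous c)
  (f12 : X1 * X2 -> R) (f13 : X1 * X3 -> R) (f23 : X2 * X3 -> R)
  (hf : dual_admissible mu1 mu2 mu3 c f12 f13 f23)
  (hmax : forall (g12 : X1 * X2 -> R) (g13 : X1 * X3 -> R) (g23 : X2 * X3 -> R),
      dual_admissible mu1 mu2 mu3 c g12 g13 g23 ->
      (dual_value mu1 mu2 mu3 g12 g13 g23 <= dual_value mu1 mu2 mu3 f12 f13 f23)%E) :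
  {ae ((mu1 \x mu2) \x mu3)%E, forall x : borel X1 * borel X2 * borel X3,
      - (12 * supnorm c) <=
      f12 (x.1.1, x.1.2) + f13 (x.1.1, x.2) + f23 (x.1.2, x.2)}.
Proof.
have opt : @optimal _ _ _ (borel X1) (borel X2) (borel X3) R mu1 mu2 mu3
    (fun x1 x2 x3 => c (x1, x2, x3)) f12 f13 f23.
  (* The two notions of admissibility agree by unfolding; only the comparison of values needs
     work. *)
  split => // g12 g13 g23 adm_g.
  have := hmax g12 g13 g23 adm_g.
  by rewrite (dual_value_fine hf) (dual_value_fine (c := c) adm_g) lee_fin.
have value_ge0 := dual_value_ge0 c_ge0 hmax.
rewrite (dual_value_fine hf) lee_fin in value_ge0.
apply: filterS (optimal_sum_ge (M := supnorm c) _ _ opt) => [x||].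
- by apply: le_trans; lra.
- by move=> *; exact: c_ge0.
- by move=> *; exact: le_supnorm.
Qed.
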